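(* For words $o_1,o_2$ among the $31$ words $$i,\ i{-}{-}i,\ i{-}{-},\ ibi,\ {-}{-}i,\ ibi{-}{-},\ {-}b{-},\ {-}{-}ibi,\ ib,\ {-}{-}ibi{-}{-},\ bi,\ {-}{-}ib,\ bi{-}{-},\ bib,\ b,\ \mathsf{id},\ {-}{-}$$ and $$i{-},\ {-}b,\ {-},\ {-}bib,\ ibi{-},\ ib{-},\ {-}ib,\ {-}bi{-}{-},\ i{-}i,\ bib{-},\ {-}bi,\ b{-},\ {-}ibi,\ {-}i$$ (where $b={-}i{-}$), the inequality $o_1\le o_2$ holds in $\mathbf{M}$ if and only if it belongs to the reflexive-transitive closure of the following $46$ relations, which are moreover exactly the covering relations (edges of the Hasse diagram) of $\mathbf{M}$. Upper component: $i\le i{-}{-}i$; $i{-}{-}i\le i{-}{-}$; $i{-}{-}i\le ibi$; $i{-}{-}i\le {-}{-}i$; $i{-}{-}\le {-}b{-}$; $i{-}{-}\le ibi{-}{-}$; $ibi\le ibi{-}{-}$; $ibi\le {-}{-}ibi$; ${-}{-}i\le {-}b{-}$; ${-}{-}i\le {-}{-}ibi$; $ibi{-}{-}\le ib$; $ibi{-}{-}\le {-}{-}ibi{-}{-}$; ${-}b{-}\le {-}{-}ibi{-}{-}$; ${-}b{-}\le {-}{-}$; ${-}{-}ibi\le {-}{-}ibi{-}{-}$; ${-}{-}ibi\le bi$; $ib\le {-}{-}ib$; ${-}{-}ibi{-}{-}\le {-}{-}ib$; ${-}{-}ibi{-}{-}\le bi{-}{-}$; $bi\le bi{-}{-}$;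 ${-}{-}ib\le bib$; $bi{-}{-}\le bib$; $bib\le b$; $i\le \mathsf{id}$; $\mathsf{id}\le {-}{-}$; ${-}{-}\le b$. Lower component: $i{-}\le {-}b$; $i{-}\le ibi{-}$; ${-}b\le {-}$; ${-}b\le {-}bib$; ${-}\le b{-}$; $b{-}\le {-}i$; $ibi{-}\le {-}bib$; $ibi{-}\le ib{-}$; ${-}bib\le {-}ib$; ${-}bib\le {-}bi{-}{-}$; $ib{-}\le {-}bi{-}{-}$; $ib{-}\le i{-}i$; ${-}ib\le bib{-}$; ${-}bi{-}{-}\le bib{-}$; ${-}bi{-}{-}\le {-}bi$; $i{-}i\le {-}bi$; $bib{-}\le b{-}$; $bib{-}\le {-}ibi$; ${-}bi\le {-}ibi$; ${-}ibi\le {-}i$.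
   Context: Let $(L,\le)$ be a poset. A pseudocomplement operator on $L$ is a map ${-}:L\to L$ such that for all $a,x\in L$: $a\le {-}x \iff x\le {-}a$. An interior operator on $L$ is an order-preserving map $i:L\to L$ with $i(x)\le x$ and $i(i(x))=i(x)$ for all $x$. $\mathsf{id}$ is the identity map. Words in $i$ and ${-}$ denote compositions (so $i{-}x=i({-}x)$), and $b$ abbreviates the word ${-}i{-}$. $\mathbf{M}$ is the monoid of words in $\{i,{-}\}$ (including the empty word $\mathsf{id}$), where two words are identified when they act as the same map on every poset $L$ for every interior operator $i$ and every pseudocomplement operator ${-}$ on $L$. It is ordered by: $o_1\le o_2$ in $\mathbf{M}$ if and only if $o_1(x)\le o_2(x)$ for every such $(L,\le,i,{-})$ and every $x\in L$. It is known (Ciraulo) that every element of $\mathbf{M}$ is represented by one of the $31$ words listed in the claim. *)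

(* Defs.v *)
From HB Require Import structures.
From mathcomp Require Import all_boot all_order.
From mathcomp Require Import boolp.

Set Implicit Arguments.
Unset Strict Implicit.
Unset Printing Implicit Defensive.

Import Order.Theory.

Section Operators.
Local Open Scope order_scope.
Context {d : Order.disp_t} {L : porderType d}.

Definition pseudocomplement_op (n : L -> L) : Prop :=
  forall a x : L, a <= n x <-> x <= n a.

Definition interior_op (i : L -> L) : Prop :=
  [/\ {homo i : x y / x <= y}, forall x, i x <= x & forall x, i (i x) = i x].

Definition covered_by (x y : L) : Prop :=
  x < y /\ ~ (exists z : L, x < z /\ z < y).

End Operators.

Variant letter := Int | Neg.

Definition bool_of_letter (l : letter) : bool := if l is Int then true else false.
Definition letter_of_bool (c : bool) : letter := if c then Int else Neg.
Lemma bool_of_letterK : cancel bool_of_letter letter_of_bool.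
Proof. by case. Qed.
HB.instance Definition _ := Finite.copy letter (can_type bool_of_letterK).

(* A word is read as a composition: its last letter is applied first, and
   concatenation of words is composition of maps. *)
Definition word := seq letter.

Definition act (L : Type) (i n : L -> L) (w : word) : L -> L :=
  fun x => foldr (fun l => if l is Int then i else n) x w.

Lemma act_cat (L : Type) (i n : L -> L) (u v : word) (x : L) :
  act i n (u ++ v) x = act i n u (act i n v x).
Proof. exact: foldr_cat. Qed.

(* With the classical axioms of boolp, the Boolean relation and the choice
   operator carried by a porderType exist on every poset, so that quantifying
   over porderType is quantifying over all posets. *)
Definition word_eq (u v : word) : Prop :=
  forall (d : Order.disp_t) (L : porderType d) (i n : L -> L),
    interior_op i -> pseudocomplement_op n ->
    forall x : L, act i n u x = act i n v x.

Definition word_le (u v : word) : Prop :=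
  forall (d : Order.disp_t) (L : porderType d) (i n : L -> L),
    interior_op i -> pseudocomplement_op n ->
    forall x : L, (act i n u x <= act i n v x)%O.

Definition word_eqb : rel word := fun u v => `[< word_eq u v >].

Lemma word_eqb_equiv : equiv_class_of word_eqb.
Proof.
split=> [u|u v|v u w].
- by apply/asboolP=> d L i n _ _ x.
- by apply/asboolP/asboolP=> uv d L i n hi hn x; rewrite uv.
- move=> /asboolP uv /asboolP vw.
  by apply/asboolP=> d L i n hi hn x; rewrite uv// vw.
Qed.

Canonical word_eqb_equivRel := EquivRelPack word_eqb_equiv.

Local Open Scope quotient_scope.

(* The monoid of words modulo word_eq; \pi_M w is the class of w, repr p is a
   chosen representative of p. *)
Definition M := {eq_quot word_eqb}.
HB.instance Definition _ := Choice.on M.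
HB.instance Definition _ := EqQuotient.on M.

Lemma pi_eqP (u v : word) : reflect (word_eq u v) (\pi_M u == \pi_M v).
Proof. by rewrite piE; exact: asboolP. Qed.

Lemma repr_piE (u : word) : word_eq (repr (\pi_M u)) u.
Proof. by apply/pi_eqP; rewrite reprK. Qed.

(* Independent of the representatives, see le_piP. *)
Definition M_le (p q : M) : bool := `[< word_le (repr p) (repr q) >].

Lemma M_le_refl : reflexive M_le.
Proof. by move=> p; apply/asboolP=> d L i n hi hn x. Qed.

Lemma M_le_anti : antisymmetric M_le.
Proof.
move=> p q /andP[/asboolP pq /asboolP qp].
rewrite -[p]reprK -[q]reprK; apply/eqP/pi_eqP=> d L i n hi hn x.
by apply/le_anti; rewrite pq// qp.
Qed.

Lemma M_le_trans : transitive M_le.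
Proof.
move=> q p r /asboolP pq /asboolP qr.
apply/asboolP=> d L i n hi hn x.
exact: le_trans (pq d L i n hi hn x) (qr d L i n hi hn x).
Qed.

Fact M_display : Order.disp_t. Proof. exact: (Order.Disp tt tt). Qed.

HB.instance Definition _ :=
  Order.Le_isPOrder.Build M_display M M_le_refl M_le_anti M_le_trans.

Lemma le_piP (u v : word) : reflect (word_le u v) (\pi_M u <= \pi_M v)%O.
Proof.
apply: (iffP (asboolP _)) => uv d L i n hi hn x.
  by rewrite -(repr_piE u hi hn) -(repr_piE v hi hn) uv.
by rewrite (repr_piE u hi hn) (repr_piE v hi hn) uv.
Qed.

Definition M_one : M := \pi_M [::].
Definition M_mul (p q : M) : M := \pi_M (repr p ++ repr q).

Lemma M_mulE (u v : word) : M_mul (\pi_M u) (\pi_M v) = \pi_M (u ++ v).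
Proof.
apply/eqP/pi_eqP=> d L i n hi hn x.
by rewrite !act_cat (repr_piE u hi hn) (repr_piE v hi hn).
Qed.

Lemma M_mulA : associative M_mul.
Proof.
move=> p q r; rewrite -[p]reprK -[q]reprK -[r]reprK.
by rewrite (M_mulE (repr q)) (M_mulE (repr p) (repr q)) 2!M_mulE catA.
Qed.

Lemma M_mul1 : left_id M_one M_mul.
Proof. by move=> p; rewrite -[p]reprK M_mulE. Qed.

Lemma M_mul1r : right_id M_one M_mul.
Proof. by move=> p; rewrite -[p]reprK M_mulE cats0. Qed.

HB.instance Definition _ := isMonoid.Build M M_mulA M_mul1 M_mul1r.

Local Notation i := [:: Int].
Local Notation n := [:: Neg].
Local Notation nn := [:: Neg; Neg].
Local Notation b := [:: Neg; Int; Neg].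

Definition upper_words : seq word :=
  [:: i; i ++ nn ++ i; i ++ nn; i ++ b ++ i; nn ++ i; i ++ b ++ i ++ nn;
      n ++ b ++ n; nn ++ i ++ b ++ i; i ++ b; nn ++ i ++ b ++ i ++ nn;
      b ++ i; nn ++ i ++ b; b ++ i ++ nn; b ++ i ++ b; b; [::]; nn].

Definition lower_words : seq word :=
  [:: i ++ n; n ++ b; n; n ++ b ++ i ++ b; i ++ b ++ i ++ n; i ++ b ++ n;
      n ++ i ++ b; n ++ b ++ i ++ nn; i ++ n ++ i; b ++ i ++ b ++ n;
      n ++ b ++ i; b ++ n; n ++ i ++ b ++ i; n ++ i].

Definition words31 : seq word := upper_words ++ lower_words.

Definition upper_edges : seq (word * word) :=
  [:: (i, i ++ nn ++ i);
      (i ++ nn ++ i, i ++ nn);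
      (i ++ nn ++ i, i ++ b ++ i);
      (i ++ nn ++ i, nn ++ i);
      (i ++ nn, n ++ b ++ n);
      (i ++ nn, i ++ b ++ i ++ nn);
      (i ++ b ++ i, i ++ b ++ i ++ nn);
      (i ++ b ++ i, nn ++ i ++ b ++ i);
      (nn ++ i, n ++ b ++ n);
      (nn ++ i, nn ++ i ++ b ++ i);
      (i ++ b ++ i ++ nn, i ++ b);
      (i ++ b ++ i ++ nn, nn ++ i ++ b ++ i ++ nn);
      (n ++ b ++ n, nn ++ i ++ b ++ i ++ nn);
      (n ++ b ++ n, nn);
      (nn ++ i ++ b ++ i, nn ++ i ++ b ++ i ++ nn);
      (nn ++ i ++ b ++ i, b ++ i);
      (i ++ b, nn ++ i ++ b);
      (nn ++ i ++ b ++ i ++ nn, nn ++ i ++ b);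
      (nn ++ i ++ b ++ i ++ nn, b ++ i ++ nn);
      (b ++ i, b ++ i ++ nn);
      (nn ++ i ++ b, b ++ i ++ b);
      (b ++ i ++ nn, b ++ i ++ b);
      (b ++ i ++ b, b);
      (i, [::]);
      ([::], nn);
      (nn, b)].

Definition lower_edges : seq (word * word) :=
  [:: (i ++ n, n ++ b);
      (i ++ n, i ++ b ++ i ++ n);
      (n ++ b, n);
      (n ++ b, n ++ b ++ i ++ b);
      (n, b ++ n);
      (b ++ n, n ++ i);
      (i ++ b ++ i ++ n, n ++ b ++ i ++ b);
      (i ++ b ++ i ++ n, i ++ b ++ n);
      (n ++ b ++ i ++ b, n ++ i ++ b);
      (n ++ b ++ i ++ b, n ++ b ++ i ++ nn);
      (i ++ b ++ n, n ++ b ++ i ++ nn);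
      (i ++ b ++ n, i ++ n ++ i);
      (n ++ i ++ b, b ++ i ++ b ++ n);
      (n ++ b ++ i ++ nn, b ++ i ++ b ++ n);
      (n ++ b ++ i ++ nn, n ++ b ++ i);
      (i ++ n ++ i, n ++ b ++ i);
      (b ++ i ++ b ++ n, b ++ n);
      (b ++ i ++ b ++ n, n ++ i ++ b ++ i);
      (n ++ b ++ i, n ++ i ++ b ++ i);
      (n ++ i ++ b ++ i, n ++ i)].

Definition edges46 : seq (word * word) := upper_edges ++ lower_edges.
Definition edge (u v : word) : Prop := (u, v) \in edges46.

(* Main.v *)
(* The 31 words form the free algebra on one generator. A cut-free sequent
   calculus for the theory of an interior and a pseudocomplement operator
   decides inequalities between words. Its derivability relation turns the set
   of the 31 words into a poset on which i and - act by left multiplication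
   followed by reduction to one of the 31; evaluating a word at the empty word
   in this model gives back the word, so every inequality valid in all models
   is derivable. The covering pairs of this finite poset are the listed edges,
   and a finite order is generated by its covering relation. *)
From HB Require Import structures.
Require Import Defs.
From Stdlib Require Import Relation_Operators.
From mathcomp Require Import all_boot all_order.

Set Implicit Arguments.
Unset Strict Implicit.
Unset Printing Implicit Defensive.

Local Open Scope quotient_scope.

(** * Soundness of the inference rules *)

Section Laws.
Local Open Scope order_scope.
Context {d : Order.disp_t} {L : porderType d} {i n : L -> L}.
Hypotheses (hi : interior_op i) (hn : pseudocomplement_op n).

Lemma int_homo x y : x <= y -> i x <= i y.
Proof. by case: hi => homo_i _ _; exact: homo_i. Qed.

Lemma int_elim x y : x <= y -> i x <= y.
Proof. by case: hi => _ le_i _; apply: Order.POrderTheory.le_trans. Qed.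

Lemma int_intro x y : i x <= y -> i x <= i y.
Proof. by case: hi => _ _ idem_i /int_homo; rewrite idem_i. Qed.

Lemma neg_neg_intro x y : x <= y -> x <= n (n y).
Proof.
by move=> xy; apply: Order.POrderTheory.le_trans xy _; apply/(hn y (n y)).
Qed.

Lemma neg_anti x y : x <= y -> n y <= n x.
Proof. by move=> /neg_neg_intro /hn. Qed.

Lemma neg_int_intro x y : x <= n y -> x <= n (i y).
Proof. by move=> /hn /int_elim /hn. Qed.

Lemma neg_neg_elim x y : x <= n y -> n (n x) <= n y.
Proof. by move=> /hn; exact: neg_anti. Qed.

End Laws.

(* Backward proof search for u <= v. Each rule shortens u ++ v, so that a fuel
   k exceeding its length is enough. The rule i x <= i y <- i x <= y is
   invertible and needs no backtracking. *)
Fixpoint derives (k : nat) (u v : word) : bool :=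
  if k is k'.+1 then
    match u, v with
    | [::], [::] => true
    | [::], Neg :: Neg :: v' => derives k' u v'
    | [::], Neg :: Int :: v' => derives k' u (Neg :: v')
    | Int :: _, Int :: v' => derives k' u v'
    | Int :: u', _ =>
      if derives k' u' v then true else
      match v with
      | Neg :: Neg :: v' => derives k' u v'
      | Neg :: Int :: v' => derives k' u (Neg :: v')
      | _ => false
      end
    | Neg :: u', Neg :: v' =>
      if derives k' v' u' then true else
      if (if u' is Neg :: u'' then derives k' u'' v else false) then true else
      match v' with
      | Neg :: v'' => derives k' u v''
      | Int :: v'' => derives k' u (Neg :: v'')
      | _ => false
      end
    | _, _ => false
    end
  else false.

Definition dle (u v : word) : bool := derives (size u + size v).+1 u v.

(** Each rule is an instance of a law above. [neg_right] gathers the two rules acting behind a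
    leading [Neg] on the right, which occur for all three shapes of the left word. *)
Lemma derives_sound (k : nat) (u v : word) : derives k u v -> word_le u v.
Proof.
move=> + d L i n hi hn x; elim: k u v => [//|k IH] u v.
have neg_right w v' :
    match v' with
    | Neg :: v'' => derives k w v''
    | Int :: v'' => derives k w (Neg :: v'')
    | _ => false
    end -> (act i n w x <= n (act i n v' x))%O.
  case: v' => [|[] v''] //= /IH /=; first exact: (neg_int_intro hi hn).
  exact: (neg_neg_intro hn).
case: u v => [|[] u] [|[] v] //=.
- exact: (neg_right [::]).
- case: ifP => [/IH h _|_ //]; exact: (int_elim hi h).
- by move=> /IH; exact: (int_intro hi).
- case: ifP => [/IH h _|_]; first exact: (int_elim hi h).
  exact: (neg_right (Int :: u)).
- case: ifP => [/IH h _|_]; first exact: (neg_anti hn h).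
  case: ifP => [|_]; last exact: (neg_right (Neg :: u)).
  by case: u => [|[] u] //= /IH h _; exact: (neg_neg_elim hn h).
Qed.

Lemma dle_sound (u v : word) : dle u v -> word_le u v.
Proof. exact: derives_sound. Qed.

(** The default [[::]] is itself a listed word, so membership of the result does not show that the
    search succeeded. *)
Definition nf (w : word) : word :=
  nth [::] words31 (find (fun v => dle w v && dle v w) words31).

(** Closure of the 31 words under left multiplication by a letter, checked in all 62 cases by
    derivations in both directions. *)
Lemma nf_cons (l : letter) (w : word) : w \in words31 ->
  nf (l :: w) \in words31 /\ word_eq (nf (l :: w)) (l :: w).
Proof.
have: all (fun w => all (fun l => [&& nf (l :: w) \in words31,
  dle (nf (l :: w)) (l :: w) & dle (l :: w) (nf (l :: w))]) [:: Int; Neg])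
  words31 by vm_compute.
have l_in : l \in [:: Int; Neg] by case: l.
move=> /allP h /h /allP /(_ l l_in) /and3P [-> /dle_sound le1 /dle_sound le2].
split=> // d L i n hi hn x.
by apply: Order.POrderTheory.le_anti; rewrite le1 ?le2.
Qed.

Lemma dle_refl : {in words31, reflexive dle}.
Proof. by apply/allP; vm_compute. Qed.

Lemma dle_anti : {in words31 &, antisymmetric dle}.
Proof.
have: all (fun u => all (fun v => dle u v && dle v u ==> (u == v)) words31)
  words31 by vm_compute.
by move=> /allP h u v /h /allP {}h /h /implyP uv /uv /eqP.
Qed.

(** Admissibility of cut on the listed words, by computation over all triples. *)
Lemma dle_trans : {in words31 & &, transitive dle}.
Proof.
have: all (fun v => all (fun u => all (fun w =>
  dle u v ==> dle v w ==> dle u w) words31) words31) words31 by vm_compute.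
move=> /allP h v u w /h /allP {}h /h /allP {}h /h.
by move=> /implyP h' uv vw; move: (h' uv); rewrite vw.
Qed.

(** * The finite model and completeness *)

Definition normal : Type := seq_sub words31.
HB.instance Definition _ := Choice.on normal.

Definition normal_le (x y : normal) : bool := dle (ssval x) (ssval y).

Lemma normal_le_refl : reflexive normal_le.
Proof. by move=> x; exact/dle_refl/ssvalP. Qed.

Lemma normal_le_anti : antisymmetric normal_le.
Proof. by move=> x y /dle_anti xy; apply/val_inj/xy; exact: ssvalP. Qed.

Lemma normal_le_trans : transitive normal_le.
Proof. by move=> y x z; apply: dle_trans; exact: ssvalP. Qed.

Fact normal_display : Order.disp_t. Proof. exact: (Order.Disp tt tt). Qed.

HB.instance Definition _ := Order.Le_isPOrder.Build normal_display normal
  normal_le_refl normal_le_anti normal_le_trans.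

Definition normal_cons (l : letter) (x : normal) : normal :=
  SeqSub (nf_cons l (ssvalP x)).1.

Lemma normal_interior : interior_op (normal_cons Int).
Proof.
split=> [x y|x|x].
- have: all (fun u => all (fun v =>
    dle u v ==> dle (nf (Int :: u)) (nf (Int :: v))) words31) words31
    by vm_compute.
  by move=> /allP /(_ _ (ssvalP x)) /allP /(_ _ (ssvalP y)) /implyP.
- have: all (fun u => dle (nf (Int :: u)) u) words31 by vm_compute.
  by move=> /allP /(_ _ (ssvalP x)).
- apply: val_inj => /=.
  have: all (fun u => nf (Int :: nf (Int :: u)) == nf (Int :: u)) words31
    by vm_compute.
  by move=> /allP /(_ _ (ssvalP x)) /eqP.
Qed.

Lemma normal_pseudocomplement : pseudocomplement_op (normal_cons Neg).
Proof.
have: all (fun u => all (fun v =>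
  dle u (nf (Neg :: v)) == dle v (nf (Neg :: u))) words31) words31
  by vm_compute.
move=> /allP h x y.
have /allP /(_ _ (ssvalP y)) /eqP xy := h _ (ssvalP x).
(* The order of [normal] is convertible to [dle] on the underlying words. *)
by rewrite [(x <= _)%O]xy.
Qed.

Lemma dle_complete : {in words31 &, forall u v, word_le u v -> dle u v}.
Proof.
have nil_in : [::] \in words31 by vm_compute.
have act_nil w : ssval (act (normal_cons Int) (normal_cons Neg) w
    (SeqSub nil_in)) = foldr (fun l => nf \o cons l) [::] w.
  by elim: w => [//|[] w IH] /=; rewrite IH.
(* Letterwise reduction returns each listed word itself, not just an equivalent one. *)
have: all (fun w => foldr (fun l => nf \o cons l) [::] w == w) words31
  by vm_compute.
move=> /allP h u v /h /eqP u_nf /h /eqP v_nf uv.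
have := uv _ _ _ _ normal_interior normal_pseudocomplement (SeqSub nil_in).
by rewrite [(_ <= _)%O]/(dle _ _) !act_nil u_nf v_nf.
Qed.

(** * Transfer to [M] *)

Lemma le_pi_dle (u v : word) : u \in words31 -> v \in words31 ->
  (\pi_M u <= \pi_M v)%O = dle u v.
Proof.
move=> u_in v_in; apply/le_piP/idP; first exact: dle_complete.
exact: dle_sound.
Qed.

Definition dlt (u v : word) : bool := dle u v && (u != v).

(** By [dle_anti], distinct listed words have distinct classes. *)
Lemma lt_pi_dlt (u v : word) : u \in words31 -> v \in words31 ->
  (\pi_M u < \pi_M v)%O = dlt u v.
Proof.
move=> u_in v_in; rewrite Order.POrderTheory.lt_neqAle le_pi_dle // /dlt andbC.
case uv: (dle u v) => //=; congr (~~ _); apply/eqP/eqP => [puv|-> //].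
by apply: dle_anti => //; rewrite uv -le_pi_dle // puv /=.
Qed.

(** Induction on a representative: the tail is replaced by a listed word and [nf_cons] absorbs the
    next letter. *)
Lemma pi_normal (p : M) : exists2 w, w \in words31 & p = \pi_M w.
Proof.
rewrite -[p]reprK; elim: (repr p) => [|l w [v v_in wv]]; first by exists [::].
have [nf_in nf_eq] := nf_cons l v_in.
exists (nf (l :: v)) => //; apply/eqP/pi_eqP => d L i n hi hn x.
rewrite nf_eq //=; have /eqP/pi_eqP -> // := wv.
Qed.

(** * Covering pairs and generation of the order *)

Definition between (u v : word) : pred word := fun z => dlt u z && dlt z v.

Lemma edgeE (u v : word) : u \in words31 -> v \in words31 ->
  ((u, v) \in edges46) = dlt u v && ~~ has (between u v) words31.
Proof.
have: all (fun u => all (fun v => ((u, v) \in edges46) ==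
  dlt u v && ~~ has (between u v) words31) words31) words31 by vm_compute.
by move=> /allP h /h /allP {}h /h /eqP.
Qed.

Lemma edge_words31 (u v : word) : edge u v -> u \in words31 /\ v \in words31.
Proof.
have: all (fun e => (e.1 \in words31) && (e.2 \in words31)) edges46
  by vm_compute.
by move=> /allP h /h /andP.
Qed.

Lemma dlt_trans : {in words31 & &, transitive dlt}.
Proof.
move=> v u w v_in u_in w_in; rewrite -!lt_pi_dlt //.
exact: Order.POrderTheory.lt_trans.
Qed.

(** The elements satisfying [t] split into those satisfying [s] and a remainder containing [z]. *)
Lemma ltn_count_in (T : eqType) (s t : pred T) (l : seq T) (z : T) :
  {in l, subpred s t} -> z \in l -> t z -> ~~ s z -> count s l < count t l.
Proof.
move=> st zl tz nsz; rewrite -(size_filter t) -(count_predC s) count_filter.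
rewrite -(@eq_in_count _ s) => [|x /st /= sub]; last first.
  by rewrite andb_idr.
by rewrite -[X in X < _]addn0 ltn_add2l -has_count; apply/hasP; exists z;
  rewrite // mem_filter tz.
Qed.

(** Strong induction on the number of listed words strictly between [u] and [v]. A pair that is not
    an edge is split at some such [z], and [z] is no longer counted in either half. *)
Lemma dlt_clos (u v : word) : u \in words31 -> v \in words31 ->
  dlt u v -> clos_refl_trans word edge u v.
Proof.
have [k] := ubnP (count (between u v) words31).
elim: k u v => // k IH u v; rewrite ltnS => lek u_in v_in uv.
case: (boolP (has (between u v) words31)) => [|nobet]; last first.
  by apply: rt_step; rewrite /edge edgeE // uv.
move=> /hasP [z z_in /andP [uz zv]].
have nzz : dlt z z = false by rewrite /dlt eqxx andbF.
have bz : between u v z by apply/andP.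
apply: (@rt_trans _ _ _ z); apply: IH => //; apply: leq_trans lek;
  apply: (@ltn_count_in _ _ _ _ z); rewrite // /between ?nzz ?andbF //.
- by move=> y y_in /andP [uy yz]; rewrite uy (@dlt_trans z).
- by move=> y y_in /andP [zy yv]; rewrite yv (@dlt_trans z).
Qed.

Theorem proposition1 :
  (forall o1 o2 : word, o1 \in words31 -> o2 \in words31 ->
     ((\pi_M o1 <= \pi_M o2)%O <-> clos_refl_trans word edge o1 o2)) /\
  (forall p q : M,
     covered_by p q <->
     exists o1 o2 : word, [/\ edge o1 o2, p = \pi_M o1 & q = \pi_M o2]).
Proof.
split=> [u v u_in v_in|p q]; [split=> [uv|]|split].
- have [<-|neq_uv] := eqVneq u v; first exact: rt_refl.
  by apply: dlt_clos; rewrite // /dlt -le_pi_dle // uv.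
- move=> uv; elim: uv {u_in v_in} => [x y xy|x|x y z _ xy _ yz].
  + have [x_in y_in] := edge_words31 xy; move: xy.
    by rewrite /edge edgeE // le_pi_dle // => /andP [/andP []].
  + exact: Order.POrderTheory.lexx.
  + exact: Order.POrderTheory.le_trans xy yz.
- have [u u_in ->] := pi_normal p; have [v v_in ->] := pi_normal q.
  rewrite /covered_by lt_pi_dlt // => -[uv nobet].
  exists u, v; split; rewrite // /edge edgeE // uv.
  apply/hasPn => z z_in; apply/negP => /andP [uz zv]; apply: nobet.
  by exists (\pi_M z); rewrite !lt_pi_dlt.
- move=> [u [v [uv -> ->]]]; have [u_in v_in] := edge_words31 uv; move: uv.
  rewrite /edge edgeE // => /andP [uv /hasPn nobet].
  split=> [|[r]]; first by rewrite lt_pi_dlt.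
  (* An arbitrary intermediate element of [M] is the class of a listed word, so the finite check
     behind [edgeE] excludes it. *)
  have [z z_in ->] := pi_normal r; rewrite !lt_pi_dlt // => -[uz zv].
  by have := nobet z z_in; rewrite /between uz zv.
Qed.
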